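(* Let $A$ be an associative algebra with involution $*$ over an algebraically closed field $F$ of characteristic zero and let $K=\mathfrak{su}^*(A)$. Let $I$ be a subspace of $K$. Then $I$ is a regular inner ideal of $K$ if and only if there exists a left ideal $\mathcal{L}$ of $A$ such that $\mathcal{L}\mathcal{L}^*=0$ and $$\mathfrak{u}^*(\mathcal{L}^*\mathcal{L})\subseteq I\subseteq\mathcal{L}^*\cap\mathcal{L}\cap K.$$ In particular, if $A$ is von Neumann regular then every regular inner ideal of $K$ is of the form $I=\mathfrak{u}^*(\mathcal{L}^*\mathcal{L})=\mathfrak{u}^*(\mathcal{L}^*\cap\mathcal{L})$ for some left ideal $\mathcal{L}$ of $A$.
   Context: Products of subspaces denote spans of products. For a $*$-invariant subspace $C$ of $A$, $\mathfrak{u}^*(C)=\{c\in C\mid c^*=-c\}$; $\mathfrak{su}^*(A)=[\mathfrak{u}^*(A),\mathfrak{u}^*(A)]$ is the commutator subalgebra of the Lie algebra $\mathfrak{u}^*(A)$. A subspace $I$ of $K=\mathfrak{su}^*(A)$ with $I^2=0$ is called a ($*$-)regular inner ideal of $K$ (with respect to $A$) if $\mathfrak{u}^*(IAI)\subseteq I$. $A$ is von Neumann regular if for every $x\in A$ there is $y\in A$ with $xyx=x$. Algebras need not have an identity. *)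

(* Defs.v *)
From HB Require Import structures.
From mathcomp Require Import all_boot all_algebra classical_sets.

Set Implicit Arguments.
Unset Strict Implicit.
Unset Printing Implicit Defensive.

Import GRing.Theory.

Local Open Scope classical_set_scope.
Local Open Scope ring_scope.

(* The algebra structures of MathComp all have an identity, so associative
   algebras without identity (of arbitrary dimension) are built here over
   left modules. *)
HB.mixin Record Lmodule_isAssocAlgebra (F : fieldType) A
    of GRing.Lmodule F A := {
  amul : A -> A -> A;
  amulA : associative amul;
  amul_linearl : forall y, linear (amul ^~ y);
  amul_linearr : forall x, linear (amul x)
}.

#[short(type="assocAlgType")]
HB.structure Definition AssocAlgebra (F : fieldType) :=
  {A of Lmodule_isAssocAlgebra F A & GRing.Lmodule F A}.

(* Involutions are of the first kind: they are F-linear. *)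
HB.mixin Record AssocAlgebra_hasInvolution (F : fieldType) A
    of AssocAlgebra F A := {
  star : A -> A;
  star_linear : linear star;
  starK : involutive star;
  starM : forall x y, star (amul x y) = amul (star y) (star x)
}.

#[short(type="invAlgType")]
HB.structure Definition InvAlgebra (F : fieldType) :=
  {A of AssocAlgebra_hasInvolution F A & AssocAlgebra F A}.

Definition subspace (F : fieldType) (V : lmodType F) (S : set V) : Prop :=
  GRing.submod_closed (mem S).

Definition lspan (F : fieldType) (V : lmodType F) (S : set V) : set V :=
  smallest (@subspace F V) S.

Section AssociativeAlgebra.
Variables (F : fieldType) (A : assocAlgType F).

Definition prods (X Y : set A) : set A :=
  lspan [set amul x y | x in X & y in Y].

Definition lie (x y : A) : A := amul x y - amul y x.

Definition lies (X Y : set A) : set A :=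
  lspan [set lie x y | x in X & y in Y].

Definition left_ideal (L : set A) : Prop :=
  subspace L /\ prods setT L `<=` L.

Definition von_neumann_regular : Prop :=
  forall x : A, exists y : A, amul (amul x y) x = x.

End AssociativeAlgebra.

Section AlgebraWithInvolution.
Variables (F : fieldType) (A : invAlgType F).

Definition stars (X : set A) : set A := star @` X.

Definition ustar (C : set A) : set A := [set c | C c /\ star c = - c].

Definition sustar : set A := lies (ustar setT) (ustar setT).

Definition regular_inner_ideal (I : set A) : Prop :=
  [/\ subspace I, I `<=` sustar, prods I I = [set 0]
    & ustar (prods (prods I setT) I) `<=` I].

End AlgebraWithInvolution.

Arguments von_neumann_regular {F} A.
Arguments sustar {F} A.

(* Main.v *)
Require Import Defs.
From HB Require Import structures.
From mathcomp Require Import all_boot all_algebra classical_sets.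

(** Commutators of skew elements are skew, so a subspace [I] of [su*(A)] is
    pointwise skew.  The left ideal attached to such an [I] is the left
    ideal [L = I + A I] that [I] generates.  Since [I] is pointwise skew, its
    star is the right ideal [L* = I + I A].  If [I I = 0], multiplying out
    gives [L L* = 0] and [L* L <= I A I] ([left_ideal_gen_mul_star],
    [prods_stars_left_ideal_gen]); so [u*(I A I) <= I] yields
    [u*(L* L) <= I].

    Conversely, if [u*(L* L) <= I <= L* /\ L], then [I I] lies in [L L* = 0],
    and [I A I] lies in [(L* A) L <= L* L] because [L*] is a right ideal.

    Finally, if [A] is von Neumann regular, each [x] in [L* /\ L] factors as
    [x (y x)] with [x] in [L*] and [y x] in [L]; hence [L* /\ L] lies in
    [L* L], and [u*(L* L) <= I <= u*(L* /\ L)] closes up to equalities. *)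

Set Implicit Arguments.
Unset Strict Implicit.
Unset Printing Implicit Defensive.

Import GRing.Theory.

Local Open Scope classical_set_scope.
Local Open Scope ring_scope.

Section Span.
Variables (F : fieldType) (V : lmodType F).
Implicit Types S G : set V.

Lemma subspaceP S :
  subspace S <-> S 0 /\ forall a u v, S u -> S v -> S (a *: u + v).
Proof.
split=> [[S0 SD]|[S0 SD]].
  split=> [|a u v Su Sv]; first by move: S0; rewrite inE.
  by rewrite -in_setE; apply: SD; rewrite inE.
split=> [|a u v]; first by rewrite inE.
by rewrite !inE; apply: SD.
Qed.

Lemma subspace_set0 : subspace [set (0 : V)].
Proof.
by apply/subspaceP; split=> // a u v /= -> ->; rewrite scaler0 addr0.
Qed.

Lemma lspan_subspace G : subspace (lspan G).
Proof.
apply/subspaceP; split=> [S [/subspaceP[]] //|a u v Gu Gv S SG].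
have /subspaceP[_ SD] := proj1 SG.
by apply: SD; [apply: Gu|apply: Gv].
Qed.

Lemma sub_lspan G : G `<=` lspan G.
Proof. exact: sub_smallest. Qed.

Lemma lspan_min G S : subspace S -> G `<=` S -> lspan G `<=` S.
Proof. exact: smallest_sub. Qed.

Lemma subspaceN S x : subspace S -> S x -> S (- x).
Proof.
by move=> /subspaceP[S0 SD] Sx; rewrite -[- x]addr0 -scaleN1r; apply: SD.
Qed.

End Span.

Section LinearSpan.
Variables (F : fieldType) (V W : lmodType F) (f : V -> W).
Hypothesis lf : linear f.

Lemma linear_fun0 : f 0 = 0.
Proof.
by have := lf (-1) 0 0; rewrite scaler0 addr0 scaleN1r addNr.
Qed.

Lemma linear_funN x : f (- x) = - f x.
Proof.
have := lf (-1) x 0.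
by rewrite linear_fun0 !addr0 !scaleN1r.
Qed.

Lemma linear_lspan (S : set W) (G : set V) :
  subspace S -> (forall g, G g -> S (f g)) ->
  forall x, lspan G x -> S (f x).
Proof.
move=> /subspaceP[S0 SD] GS; apply: (@lspan_min _ _ _ (f @^-1` S)) => //.
apply/subspaceP; split=> [|a u v Su Sv] /=; last by rewrite lf; apply: SD.
by rewrite linear_fun0.
Qed.

End LinearSpan.

Section Products.
Variables (F : fieldType) (A : assocAlgType F).
Implicit Types S X Y G H L : set A.

Lemma amulNr (x y : A) : amul x (- y) = - amul x y.
Proof. exact: (linear_funN (amul_linearr x)). Qed.

Lemma amulNl (x y : A) : amul (- x) y = - amul x y.
Proof. exact: (linear_funN (amul_linearl y)). Qed.

Lemma amul0l (x : A) : amul 0 x = 0.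
Proof. exact: (linear_fun0 (amul_linearl x)). Qed.

Lemma amul0r (x : A) : amul x 0 = 0.
Proof. exact: (linear_fun0 (amul_linearr x)). Qed.

Lemma mem_prods X Y x y : X x -> Y y -> prods X Y (amul x y).
Proof. by move=> Xx Yy; apply: sub_lspan; exists x => //; exists y. Qed.

Lemma prods_min X Y S : subspace S ->
  (forall x y, X x -> Y y -> S (amul x y)) -> prods X Y `<=` S.
Proof.
by move=> sS XYS; apply: lspan_min => // _ [x Xx [y Yy <-]]; apply: XYS.
Qed.

Lemma amul_lspan G H S : subspace S ->
  (forall g h, G g -> H h -> S (amul g h)) ->
  forall x y, lspan G x -> lspan H y -> S (amul x y).
Proof.
move=> sS GHS x y Gx Hy.
apply: (linear_lspan (amul_linearl y) sS _ Gx) => g Gg.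
by apply: (linear_lspan (amul_linearr g) sS _ Hy) => h; apply: GHS.
Qed.

Lemma prods_eq0P X Y :
  prods X Y = [set 0] <-> (forall x y, X x -> Y y -> amul x y = 0).
Proof.
split=> [XY0 x y Xx Yy|XY0].
  by have := mem_prods Xx Yy; rewrite XY0.
apply/seteqP; split; first exact: prods_min (subspace_set0 _) XY0.
by move=> _ ->; case/subspaceP: (lspan_subspace [set amul x y | x in X & y in Y]).
Qed.

Lemma left_ideal_mul L a x : left_ideal L -> L x -> L (amul a x).
Proof. by move=> [_ AL] Lx; apply: AL; apply: mem_prods. Qed.

(** [A] need not have an identity, so [X] has to be adjoined to [A X]. *)
Definition left_ideal_gens X : set A :=
  X `|` [set amul a x | a in setT & x in X].

Definition left_ideal_gen X : set A := lspan (left_ideal_gens X).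

Lemma sub_left_ideal_gen X : X `<=` left_ideal_gen X.
Proof. by move=> x Xx; apply: sub_lspan; left. Qed.

Lemma left_ideal_genP X : left_ideal (left_ideal_gen X).
Proof.
have sL := lspan_subspace (left_ideal_gens X).
split=> //; apply: prods_min => // a x _ Lx.
apply: (linear_lspan (amul_linearr a) sL _ Lx) => g [Xg|[b _ [y Xy <-]]].
  by apply: sub_lspan; right; exists a => //; exists g.
by rewrite amulA; apply: sub_lspan; right; exists (amul a b) => //; exists y.
Qed.

End Products.

Section Involution.
Variables (F : fieldType) (A : invAlgType F).
Implicit Types I G L : set A.

Lemma starN (x : A) : star (- x) = - star x.
Proof. exact: (linear_funN (@star_linear F A)). Qed.

Lemma starB (x y : A) : star (x - y) = star x - star y.
Proof. by rewrite addrC -scaleN1r star_linear scaleN1r addrC. Qed.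

Lemma stars_lspan G : stars (lspan G) `<=` lspan (stars G).
Proof.
move=> _ [y Gy <-]; apply: (linear_lspan (@star_linear F A) _ _ Gy).
  exact: lspan_subspace.
by move=> g Gg; apply: sub_lspan; exists g.
Qed.

Lemma skew_sub_stars I L : subspace L ->
  I `<=` ustar setT -> I `<=` L -> I `<=` stars L.
Proof.
move=> sL Iskew IL x Ix; exists (- x); first by apply: subspaceN (IL _ Ix).
by rewrite starN (proj2 (Iskew _ Ix)) opprK.
Qed.

Lemma sustar_skew : sustar A `<=` ustar setT.
Proof.
apply: lspan_min => [|_ [x [_ xN] [y [_ yN] <-]]].
  apply/subspaceP; split=> [|a u v [_ uN] [_ vN]]; split=> //.
    by rewrite oppr0 (linear_fun0 (@star_linear F A)).
  by rewrite star_linear uN vN scalerN opprD.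
split=> //; rewrite /lie starB !starM xN yN.
by rewrite !amulNl !amulNr !opprK opprB.
Qed.

Lemma stars_mulr L x a : left_ideal L -> stars L x -> stars L (amul x a).
Proof.
move=> idL [y Ly <-]; exists (amul (star a) y); first exact: left_ideal_mul.
by rewrite starM starK.
Qed.

Lemma stars_left_ideal_gens I g : I `<=` ustar setT ->
  stars (left_ideal_gens I) g ->
  exists2 u, I u & g = - u \/ exists a, g = - amul u a.
Proof.
move=> Iskew [h [Ih|[a _ [u Iu <-]]] <-]; [exists h|exists u] => //.
  by left; rewrite (proj2 (Iskew _ Ih)).
by right; exists (star a); rewrite starM (proj2 (Iskew _ Iu)) amulNl.
Qed.

Section SquareZero.
Variable I : set A.
Hypothesis Iskew : I `<=` ustar setT.
Hypothesis II0 : forall u v, I u -> I v -> amul u v = 0.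

(** Every product of a generator [u] or [a u] by a generator [v] or [v b]
    contains the factor [u v = 0]. *)
Lemma left_ideal_gen_mul_star x y :
  left_ideal_gen I x -> stars (left_ideal_gen I) y -> amul x y = 0.
Proof.
move=> Lx /stars_lspan Ly.
apply: (amul_lspan (subspace_set0 A) _ Lx Ly) => g h Gg.
case/(stars_left_ideal_gens Iskew) => v Iv hE /=.
have gv0 : amul g v = 0.
  case: Gg => [Ig|[a _ [u Iu <-]]]; first exact: II0.
  by rewrite -amulA (II0 Iu Iv) amul0r.
by case: hE => [->|[b ->]]; rewrite amulNr ?amulA gv0 ?amul0l oppr0.
Qed.

(** Of the four kinds of products of generators, [u v] vanishes, while
    [u (a v)], [(u b) v] and [(u b) (a v)] belong to [(I A) I]. *)
Lemma prods_stars_left_ideal_gen :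
  prods (stars (left_ideal_gen I)) (left_ideal_gen I)
    `<=` prods (prods I setT) I.
Proof.
have sIAI := lspan_subspace [set amul x y | x in prods I setT & y in I].
have IAI u a v : I u -> I v -> prods (prods I setT) I (amul (amul u a) v).
  by move=> Iu Iv; apply: mem_prods => //; apply: mem_prods.
apply: prods_min => // x y /stars_lspan Lx Ly.
apply: (amul_lspan sIAI _ Lx Ly) => g h /(stars_left_ideal_gens Iskew) [u Iu].
case=> [->|[b ->]] [Ih|[a _ [v Iv <-]]]; rewrite amulNl; apply: (subspaceN sIAI).
- by rewrite II0 //; case/subspaceP: sIAI.
- by rewrite amulA; apply: IAI.
- exact: IAI.
- by rewrite amulA -[amul (amul u b) a]amulA; apply: IAI.
Qed.

End SquareZero.

Lemma regular_inner_ideal_left_ideal I : regular_inner_ideal I ->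
  exists L : set A,
    [/\ left_ideal L,
        prods L (stars L) = [set 0],
        ustar (prods (stars L) L) `<=` I
      & I `<=` stars L `&` L `&` sustar A].
Proof.
move=> [sI IK /prods_eq0P II0 IAI].
have Iskew := subset_trans IK sustar_skew.
have idL := left_ideal_genP I.
exists (left_ideal_gen I); split=> //.
- exact/prods_eq0P/left_ideal_gen_mul_star.
- move=> x [LLx xN]; apply: IAI; split=> //.
  exact: prods_stars_left_ideal_gen LLx.
- have IL := @sub_left_ideal_gen _ _ I.
  move=> x Ix; split; [split|]; [|exact: IL|exact: IK].
  by apply: (skew_sub_stars _ Iskew IL Ix); case: idL.
Qed.

Lemma left_ideal_regular_inner_ideal I L : subspace I -> left_ideal L ->
  prods L (stars L) = [set 0] -> ustar (prods (stars L) L) `<=` I ->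
  I `<=` stars L `&` L `&` sustar A -> regular_inner_ideal I.
Proof.
move=> sI idL /prods_eq0P LL0 LLI IL.
split=> //; first by move=> x /IL[].
  by apply/prods_eq0P => u v /IL[[_ Lu] _] /IL[[Lv _] _]; apply: LL0.
have IA u a : I u -> stars L (amul u a).
  by move=> /IL[[Lu _] _]; apply: stars_mulr.
have IAL : prods (prods I setT) I `<=` prods (stars L) L.
  apply: prods_min => [|x v IAx /IL[[_ Lv] _]]; first exact: lspan_subspace.
  apply: (linear_lspan (amul_linearl v) _ _ IAx); first exact: lspan_subspace.
  by move=> _ [u Iu [a _ <-]]; apply: mem_prods => //; apply: IA.
by move=> x [/IAL LLx xN]; apply: LLI; split.
Qed.

Lemma von_neumann_regular_setI L : von_neumann_regular A -> left_ideal L ->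
  stars L `&` L `<=` prods (stars L) L.
Proof.
move=> vnA idL x [Lsx Lx]; have [y xyx] := vnA x.
by rewrite -xyx -amulA; apply: mem_prods => //; apply: left_ideal_mul.
Qed.

End Involution.

Theorem proposition4p11 (F : closedFieldType) (charF0 : [pchar F] =i pred0)
    (A : invAlgType F) :
  (forall I : set A, subspace I -> I `<=` sustar A ->
     (regular_inner_ideal I <->
      exists L : set A,
        [/\ left_ideal L,
            prods L (stars L) = [set 0],
            ustar (prods (stars L) L) `<=` I
          & I `<=` stars L `&` L `&` sustar A]))
  /\
  (von_neumann_regular A ->
   forall I : set A, regular_inner_ideal I ->
     exists L : set A,
       [/\ left_ideal L,
           I = ustar (prods (stars L) L)
         & I = ustar (stars L `&` L)]).
Proof.
split=> [I sI IK|vnA I regI].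
  split; first exact: regular_inner_ideal_left_ideal.
  by case=> L [idL LL0 LLI IL]; apply: left_ideal_regular_inner_ideal IL.
have [L [idL _ LLI IL]] := regular_inner_ideal_left_ideal regI.
have IcapL : I `<=` ustar (stars L `&` L).
  by move=> x /IL[Lx /sustar_skew[_ xN]].
have capLL : ustar (stars L `&` L) `<=` ustar (prods (stars L) L).
  by move=> x [Lx xN]; split=> //; apply: von_neumann_regular_setI.
exists L; split=> //; apply/seteqP; split=> //.
  exact: subset_trans IcapL capLL.
exact: subset_trans capLL LLI.
Qed.
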